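(* Let $n$ be a fixed natural number, and let $K$, $x$, $y$, $q$ be sufficiently large integers satisfying $K \le y < x$. Let $$f(u) = \alpha u^n + \alpha_{n-1}u^{n-1} + \ldots + \alpha_1 u$$ be a polynomial of degree $n$ with real coefficients, where $$\alpha = \frac{a}{q} + \frac{\theta}{q^2}, \qquad (a,q)=1,\quad q\ge 1,\qquad |\theta|\le 1 .$$ Then $$V_n(K,x,y) = \sum_{k=1}^K \left| \sum_{x-y<p\le x} e(k f(p)) \right| \ll K y \left( \frac{1}{q} + \frac{1}{y} + \frac{q}{K y^n} + \frac{1}{K^{2^{n-1}}} \right)^{2^{-n-1}} \mathscr{L}^{\frac{n^2}{2^{n+1}}},$$ where $\mathscr{L} = \ln x$.
   Context: Here $e(t) = e^{2\pi i t}$, the inner sum runs over prime numbers $p$ in the interval $(x-y, x]$, and the implied constant in $\ll$ may depend on $n$. *)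

(* Defs.v *)
From HB Require Import structures.
From mathcomp Require Import all_boot all_order all_algebra.
From mathcomp Require Import complex.
From mathcomp Require Import all_classical all_reals all_analysis.

Set Implicit Arguments.
Unset Strict Implicit.
Unset Printing Implicit Defensive.

Import Order.TTheory GRing.Theory Num.Theory.

Local Open Scope ring_scope.
Local Open Scope complex_scope.

(* e(t) = exp(2 pi i t), with exp(i s) = cos s + i sin s for real s *)
Definition e (R : realType) (t : R) : R[i] :=
  cos (2 * pi * t) +i* sin (2 * pi * t).

(* [normc] is the modulus of a complex number as an element of R, whereas
   [`|z|] would live in R[i]. The truncated subtraction [x - y] is the usual
   one as soon as y <= x. *)
Definition V (R : realType) (f : {poly R}) (K x y : nat) : R :=
  \sum_(1 <= k < K.+1)
     ComplexField.Normc.normc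
       (\sum_((x - y).+1 <= p < x.+1 | prime p) e (k%:R * f.[p%:R])).

(* Main.v *)
Require Import Defs.
From HB Require Import structures.
From mathcomp Require Import all_boot all_order all_algebra.
From mathcomp Require Import complex.
From mathcomp Require Import all_classical all_reals all_analysis.
From mathcomp Require Import ring lra zify.

(* The primality of p plays no role. Write V as a bilinear form in k and u with
   unimodular weights in k; Cauchy's inequality in u over all integers of
   (x - y, x] gives V^2 <= y K (y + 2 sum_{h < K} |T_h|), where T_h is the
   complete sum of e(h f(u)). With n = s + 1, s Weyl differencing steps bound
   sum_h |T_h|^(2^s) by sums of min(y, 1/||n! alpha m||) weighted by the number
   of factorisations of m into n factors, m <= K y^(n-1). A second Cauchy
   inequality separates the weights, whose mean square is O(log^(n^2)), from
   sum_m min(y, 1/||alpha m||)^2, which is estimated over blocks of q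
   consecutive m using alpha = a/q + O(1/q^2). *)

Import Order.TTheory GRing.Theory Num.Theory.
Import numFieldNormedType.Exports.

Local Open Scope ring_scope.
Local Notation normc := ComplexField.Normc.normc.

(** * Finite sums *)

Section FiniteSums.
Context {R : realFieldType}.

(** The exponent 2^(n+1) collects three operations: squaring V, raising the sums over h to the power
    2^(n-1) for Weyl differencing, and squaring once more to remove the divisor weights. Treating
    the weights in mean square, rather than pointwise, keeps their cost to a power of the logarithm.
    It also turns min(y, 1/||t||) into its square, whose sum over a complete residue system modulo q
    is O(y^2 + y q) with no logarithm, because the sum of 1/l^2 converges. The divisor weights are
    thus the only source of logarithms. The diagonal terms left by the Cauchy steps are absorbed by
    1/y and 1/K^(2^(n-1)). Inequalities are kept multiplied out by powers of y and K so that
    exponents stay natural; real powers enter only with the final root. *)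

Lemma sum_CauchySchwarz (I : Type) (r : seq I) (a b : I -> R) :
  (\sum_(i <- r) a i * b i) ^+ 2 <=
  (\sum_(i <- r) a i ^+ 2) * (\sum_(i <- r) b i ^+ 2).
Proof.
(* Lagrange's identity: this double sum of squares is twice the difference of the two sides. *)
have : 0 <= \sum_(i <- r) \sum_(j <- r) (a i * b j - a j * b i) ^+ 2.
  by apply: sumr_ge0 => i _; apply: sumr_ge0 => j _; exact: sqr_ge0.
set S := \sum_(i <- r) a i * b i.
set A := \sum_(i <- r) a i ^+ 2; set B := \sum_(i <- r) b i ^+ 2.
have -> : \sum_(i <- r) \sum_(j <- r) (a i * b j - a j * b i) ^+ 2 =
          A * B + B * A - 2 * (S * S).
  rewrite [A * B]big_distrlr [B * A]big_distrlr [S * S]big_distrlr /=.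
  rewrite mulr_sumr -big_split -sumrB; apply: eq_bigr => i _ /=.
  rewrite mulr_sumr -big_split -sumrB; apply: eq_bigr => j _ /=.
  by ring.
by rewrite expr2; lra.
Qed.

Lemma sqr_sum_le (I : Type) (r : seq I) (a : I -> R) :
  (\sum_(i <- r) a i) ^+ 2 <= (size r)%:R * \sum_(i <- r) a i ^+ 2.
Proof.
have := @sum_CauchySchwarz _ r (fun=> 1) a.
under eq_bigr do rewrite mul1r.
by rewrite expr1n big_const_seq iter_addr_0 count_predT.
Qed.

(** Hölder's inequality for the exponent 2^s, by iterating Cauchy. The factor [k] on the left
    replaces the exponent 2^s - 1 on the right, and [k] may exceed the number of terms. *)
Lemma sum_pow2_le (I : Type) (r : seq I) (a : I -> R) (k : R) (s : nat) :
  0 < k -> (size r)%:R <= k -> (forall i, 0 <= a i) ->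
  k * (\sum_(i <- r) a i) ^+ (2 ^ s) <=
  k ^+ (2 ^ s) * \sum_(i <- r) a i ^+ (2 ^ s).
Proof.
move=> k0 rk a0; elim: s => [|s IH]; first by rewrite !expr1.
rewrite expnS mulnC !exprM.
rewrite -(ler_pM2l k0) mulrA -expr2 -exprMn.
apply: (@le_trans _ _ ((k ^+ (2 ^ s) * \sum_(i <- r) a i ^+ (2 ^ s)) ^+ 2)).
  apply: lerXn2r; rewrite ?nnegrE ?mulr_ge0 ?exprn_ge0 ?(ltW k0) ?sumr_ge0 //.
  by move=> i _; rewrite exprn_ge0.
rewrite exprMn [leRHS]mulrCA ler_wpM2l ?exprn_ge0 ?(ltW k0) //.
apply: (le_trans (sqr_sum_le _ _ _)).
rewrite (eq_bigr (fun i => a i ^+ (2 ^ s * 2))) => [|i _]; last by rewrite exprM.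
by rewrite ler_wpM2r // sumr_ge0 // => i _; rewrite exprn_ge0.
Qed.

Lemma exprD_le (a b : R) (m : nat) : 0 <= a -> 0 <= b ->
  (a + b) ^+ m <= 2 ^+ m * (a ^+ m + b ^+ m).
Proof.
move=> a0 b0.
have le_max (c d : R) : 0 <= c -> 0 <= d -> d <= c ->
    (c + d) ^+ m <= 2 ^+ m * (c ^+ m + d ^+ m).
  move=> c0 d0 dc; rewrite mulrDr -exprMn ler_wpDr //; first by rewrite mulr_ge0 ?exprn_ge0.
  by apply: lerXn2r; rewrite ?nnegrE; lra.
case: (lerP b a) => [|/ltW] ba; first exact: le_max.
by rewrite addrC [X in _ * X]addrC; exact: le_max.
Qed.

End FiniteSums.

(** * Divisor functions *)

Section DivisorSums.

Lemma ler_sum_index_iota (R : realDomainType) (F : nat -> R) (m n n' : nat) :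
  (n <= n')%N -> (forall i, 0 <= F i) ->
  \sum_(m <= i < n) F i <= \sum_(m <= i < n') F i.
Proof.
move=> nn' F0; case: (leqP m n) => [mn|nm].
  by rewrite (@big_cat_nat _ _ _ n m n') //= ler_wpDr // sumr_ge0.
by rewrite big_geq ?(ltnW nm) // sumr_ge0.
Qed.

(** The ranges of u and v no longer depend on m, so that a sum over m can be exchanged with them. *)
Lemma divisor_sumE (V : nmodType) (F : nat -> nat -> V) (X m : nat) :
  (0 < m <= X)%N ->
  \sum_(1 <= u < m.+1 | (u %| m)%N) F u (m %/ u)%N =
  \sum_(1 <= u < X.+1) \sum_(1 <= v < X.+1 | m == (u * v)%N) F u v.
Proof.
move=> /andP[m0 mX].
rewrite (@big_cat_nat _ _ _ m.+1 1 X.+1) //= [X in _ = _ + X]big_nat_cond.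
rewrite [X in _ = _ + X]big1 ?addr0; last first.
  move=> u /andP[/andP[mu uX] _]; rewrite big_nat_cond big1 //.
  by move=> v /andP[/andP[v1 vX] /eqP uvm]; move: uvm mu; nia.
rewrite [LHS]big_mkcond; apply: eq_big_nat => u /andP[u1 um].
rewrite (eq_bigl (fun v => (u %| m)%N && (v == m %/ u)%N)); last first.
  move=> v /=; apply/eqP/andP => [->|[um' /eqP ->]].
    by rewrite dvdn_mulr // mulKn.
  by rewrite mulnC divnK.
case: ifP => [um'|_]; last by rewrite big_pred0_eq.
rewrite big_nat1_eq ltnS (leq_trans (leq_div _ _) mX) andbT.
by rewrite divn_gt0 // dvdn_leq.
Qed.

(** All pairs (u, v) with u v <= X lie in the square of side X. *)
Lemma divisor_sum_le (R : realFieldType) (F : nat -> nat -> R) (X : nat) :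
  (forall u v, 0 <= F u v) ->
  \sum_(1 <= m < X.+1) \sum_(1 <= u < m.+1 | (u %| m)%N) F u (m %/ u)%N <=
  \sum_(1 <= u < X.+1) \sum_(1 <= v < X.+1) F u v.
Proof.
move=> F0.
rewrite (eq_big_nat _ _ (fun m => @divisor_sumE R F X m : (1 <= m < X.+1)%N -> _)).
rewrite exchange_big /=; apply: ler_sum => u _.
under eq_bigr do rewrite big_mkcond.
rewrite exchange_big /=; apply: ler_sum => v _.
by rewrite -big_mkcond big_nat1_eq; case: ifP.
Qed.

Lemma sum_mul_le_divisor_sum (R : realFieldType) (F : nat -> nat -> R)
    (U V : nat) :
  (forall u v, 0 <= F u v) ->
  \sum_(1 <= u < U.+1) \sum_(1 <= v < V.+1) F u v <=
  \sum_(1 <= m < (U * V).+1) \sum_(1 <= u < m.+1 | (u %| m)%N) F u (m %/ u)%N.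
Proof.
move=> F0.
rewrite (eq_big_nat _ _
  (fun m => @divisor_sumE R F (U * V) m : (1 <= m < (U * V).+1)%N -> _)).
rewrite [leRHS]exchange_big /=.
case: (posnP V) => [->|V0].
  rewrite [leLHS]big1; last by move=> u _; rewrite big_geq.
  by do 3!(apply: sumr_ge0 => ? _).
apply: le_trans (ler_sum_index_iota _ _ _ U.+1 _ _ _); last 2 first.
- by rewrite ltnS leq_pmulr.
- by move=> u; apply: sumr_ge0 => m _; apply: sumr_ge0.
apply: ler_sum_nat => u /andP[u0 uU].
under [leRHS]eq_bigr do rewrite big_mkcond.
rewrite [leRHS]exchange_big /=.
apply: le_trans (ler_sum_index_iota _ _ _ V.+1 _ _ _); last 2 first.
- by rewrite ltnS leq_pmull //; nia.
- by move=> v; apply: sumr_ge0 => m _; case: ifP.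
apply: ler_sum_nat => v /andP[v0 vV].
by rewrite -big_mkcond big_nat1_eq ifT // muln_gt0 u0 v0 ltnS leq_mul.
Qed.

(* [tau k m] is the number of factorisations of [m] into [k.+1] factors. *)
Fixpoint tau (k m : nat) : nat :=
  if k is k'.+1 then (\sum_(1 <= u < m.+1 | u %| m) tau k' (m %/ u))%N else 1%N.

Lemma tauS (k m : nat) :
  tau k.+1 m = (\sum_(1 <= u < m.+1 | u %| m) tau k (m %/ u))%N.
Proof. by []. Qed.

(* A divisor w of u v factors as s t with s = gcd(w, u) and t | v. *)
Lemma tau_mul_le (k u v : nat) : (0 < u)%N -> (0 < v)%N ->
  (tau k (u * v) <= tau k u * tau k v)%N.
Proof.
elim: k u v => [//|k IH] u v u0 v0.
rewrite !tauS big_distrlr /=.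
pose g w := tau k ((u * v) %/ w).
apply: (@leq_trans (\sum_(1 <= s < u.+1 | s %| u)
                      \sum_(1 <= t < v.+1 | t %| v) g (s * t))%N); last first.
  rewrite big_seq_cond [X in (_ <= X)%N]big_seq_cond.
  apply: leq_sum => s /andP[]; rewrite mem_index_iota => /andP[s0 _] su.
  rewrite big_seq_cond [X in (_ <= X)%N]big_seq_cond.
  apply: leq_sum => t /andP[]; rewrite mem_index_iota => /andP[t0 _] tv.
  rewrite /g; have -> : ((u * v) %/ (s * t) = (u %/ s) * (v %/ t))%N.
    have [[a ua] [b vb]] := (dvdnP su, dvdnP tv).
    by rewrite ua vb mulnACA !mulnK ?muln_gt0 ?s0.
  by apply: IH; rewrite divn_gt0 // dvdn_leq.
(* Each w is charged to one pair (s, t) with s t = w; after exchanging the sums, a pair receives at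
   most one w. *)
apply: (@leq_trans (\sum_(1 <= w < (u * v).+1 | w %| u * v)
    \sum_(1 <= s < u.+1 | s %| u) \sum_(1 <= t < v.+1 | t %| v)
      if w == s * t then g w else 0)%N).
  rewrite big_seq_cond [X in (_ <= X)%N]big_seq_cond.
  apply: leq_sum => w /andP[]; rewrite mem_index_iota => /andP[w0 _] wuv.
  pose s := gcdn w u; pose t := (w %/ s)%N.
  have s0 : (0 < s)%N by rewrite gcdn_gt0 w0.
  have su : (s %| u)%N by exact: dvdn_gcdr.
  have wst : w = (s * t)%N by rewrite mulnC divnK ?dvdn_gcdl.
  have tv : (t %| v)%N.
    have [a ua] := dvdnP su.
    (* Dividing w and u by their gcd s leaves coprime t and a, so t | a v forces t | v. *)
    have ta : coprime t a.
      have: gcdn (t * s) (a * s) = s by rewrite -ua mulnC -wst.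
      by rewrite -muln_gcdl -[RHS]mul1n => /eqP; rewrite eqn_pmul2r.
    rewrite -(Gauss_dvdr _ ta) -(dvdn_pmul2r s0) mulnAC -ua mulnC -wst.
    exact: wuv.
  have t0 : (0 < t)%N by rewrite (dvdn_gt0 v0 tv).
  rewrite (big_rem s) /=; last by rewrite mem_index_iota s0 ltnS dvdn_leq.
  rewrite su (big_rem t) /=; last by rewrite mem_index_iota t0 ltnS dvdn_leq.
  by rewrite tv -wst eqxx -addnA leq_addr.
rewrite exchange_big /=; apply: leq_sum => s _.
rewrite exchange_big /=; apply: leq_sum => t _.
by rewrite -big_mkcondr big_nat1_cond_eq; case: ifP.
Qed.

(** Expanding the power of the harmonic sum yields a term 1/m for each factorisation of m, and the
    factors of m <= X are themselves at most X. *)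
Lemma sum_tau_div_le (R : realFieldType) (k X : nat) :
  \sum_(1 <= m < X.+1) (tau k m)%:R / m%:R <=
  (\sum_(1 <= m < X.+1) m%:R^-1) ^+ k.+1 :> R.
Proof.
elim: k => [|k IH]; first by under eq_bigr do rewrite mul1r.
rewrite exprS; apply: le_trans (ler_wpM2l _ IH); last first.
  by apply: sumr_ge0 => m _; rewrite invr_ge0.
rewrite big_distrlr /=.
pose F (u v : nat) : R := u%:R^-1 * ((tau k v)%:R / v%:R).
have F0 u v : 0 <= F u v by rewrite /F !mulr_ge0 ?invr_ge0.
apply: le_trans (divisor_sum_le _ _ X F0).
apply: ler_sum_nat => m /andP[m0 _].
rewrite natr_sum mulr_suml.
rewrite big_seq_cond [leRHS]big_seq_cond; apply: ler_sum => u /andP[].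
rewrite mem_index_iota => /andP[u0 _] um.
have -> : (m%:R : R) = u%:R * (m %/ u)%:R by rewrite -natrM mulnC divnK.
by rewrite /F invfM mulrCA.
Qed.

(** Induction on [j] removes one factor u from m = u v at a time: [tau_mul_le] splits [tau k m], and
    the sum over u costs [k.+1] harmonic sums. The case [j = k] gives the exponent n^2 of the
    logarithm, with n = k + 1. *)
Lemma sum_tau_tau_div_le (R : realFieldType) (j k X : nat) :
  \sum_(1 <= m < X.+1) (tau j m)%:R * (tau k m)%:R / m%:R <=
  (\sum_(1 <= m < X.+1) m%:R^-1) ^+ (j.+1 * k.+1) :> R.
Proof.
elim: j => [|j IH].
  by under eq_bigr do rewrite mul1r; rewrite mul1n sum_tau_div_le.
rewrite mulSn exprD; apply: le_trans (ler_pM _ _ (sum_tau_div_le _ _ _) IH).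
- rewrite big_distrlr /=.
  pose F (u v : nat) : R :=
    (tau k u)%:R / u%:R * ((tau j v)%:R * (tau k v)%:R / v%:R).
  have F0 u v : 0 <= F u v by rewrite /F !mulr_ge0 ?invr_ge0.
  apply: le_trans (divisor_sum_le _ _ X F0).
  apply: ler_sum_nat => m /andP[m0 _].
  rewrite natr_sum !mulr_suml.
  rewrite big_seq_cond [leRHS]big_seq_cond; apply: ler_sum => u /andP[].
  rewrite mem_index_iota => /andP[u0 _] um.
  have mu : (m = u * (m %/ u))%N by rewrite mulnC divnK.
  have mu0 : (0 < m %/ u)%N by rewrite divn_gt0 // dvdn_leq.
  rewrite /F {2 3}mu natrM invfM.
  set v := (m %/ u)%N in mu0 *.
  have -> : (tau k u)%:R / u%:R * ((tau j v)%:R * (tau k v)%:R / v%:R) =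
    (tau j v)%:R * ((tau k u) * (tau k v))%:R * (u%:R^-1 / v%:R) :> R.
    by rewrite natrM; ring.
  apply: ler_wpM2r; first by rewrite mulr_ge0 ?invr_ge0.
  by apply: ler_wpM2l => //; rewrite ler_nat tau_mul_le.
- by apply: sumr_ge0 => m _; rewrite mulr_ge0 ?invr_ge0.
- by apply: sumr_ge0 => m _; rewrite !mulr_ge0 ?invr_ge0.
Qed.

Lemma sum_tau_sqr_le (R : realFieldType) (k X : nat) :
  \sum_(1 <= m < X.+1) (tau k m)%:R ^+ 2 <=
  X%:R * (\sum_(1 <= m < X.+1) m%:R^-1) ^+ (k.+1 ^ 2) :> R.
Proof.
apply: le_trans (ler_wpM2l (ler0n _ _) (sum_tau_tau_div_le R k k X)).
rewrite mulr_sumr; apply: ler_sum_nat => m /andP[m0 mX].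
rewrite -expr2 mulrCA ler_peMr ?exprn_ge0 //.
by rewrite ler_pdivlMr ?ltr0n // mul1r ler_nat.
Qed.

End DivisorSums.

(** * Exponential sums *)

Section ExponentialSums.
Context {R : realType}.
Implicit Types (s t : R) (z w : R[i]).

Lemma normc_ge0 z : 0 <= normc z.
Proof. by case: z => a b; exact: sqrtr_ge0. Qed.

Lemma normc_sum (I : Type) (r : seq I) (P : pred I) (F : I -> R[i]) :
  normc (\sum_(i <- r | P i) F i) <= \sum_(i <- r | P i) normc (F i).
Proof.
elim/big_ind2 : _ => [|x a y b xa yb|//]; first by rewrite ComplexField.Normc.normc0.
exact: le_trans (le_normcD _ _) (lerD xa yb).
Qed.

Lemma normc_conj z : normc (conjc z) = normc z.
Proof. by case: z => a b; rewrite /= sqrrN. Qed.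

Lemma Re_le_normc z : complex.Re z <= normc z.
Proof.
case: z => a b /=; apply: le_trans (ler_norm _) _.
by rewrite -sqrtr_sqr ler_wsqrtr // lerDl sqr_ge0.
Qed.

Lemma sqr_normc_Re z : normc z ^+ 2 = complex.Re (z * conjc z).
Proof.
case: z => a b /=; rewrite sqr_sqrtr ?addr_ge0 ?sqr_ge0 //.
by rewrite mulrN opprK !expr2.
Qed.

Lemma e0 : e (0 : R) = 1.
Proof. by rewrite /e mulr0 cos0 sin0. Qed.

Lemma eD s t : e (s + t) = e s * e t.
Proof.
rewrite /e mulrDr cosD sinD; apply/eqP; rewrite eq_complex /= eqxx /=.
by rewrite addrC [X in X + _]mulrC [X in _ + X]mulrC addrC eqxx.
Qed.

Lemma eN t : e (- t) = conjc (e t).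
Proof. by rewrite /e mulrN cosN sinN. Qed.

Lemma normc_e t : normc (e t) = 1.
Proof. by rewrite /e /= cos2Dsin2 sqrtr1. Qed.

Lemma e_nat (m : nat) : e (m%:R : R) = 1.
Proof.
elim: m => [|m IH]; first exact: e0.
rewrite -natr1 eD IH mul1r /e mulr1.
by rewrite (_ : 2 * pi = pi *+ 2) ?cos2pi ?sin2pi // mulr_natl.
Qed.

Lemma e_int (m : int) : e (m%:~R : R) = 1.
Proof.
case: m => m; first exact: e_nat.
by rewrite NegzE mulrNz eN e_nat conjc1.
Qed.

(** A weak form of Jordan's inequality. If it failed, the mean value theorem would give sin x = x
    cos c with cos c < 1/4, while sin c < sin x < 1/2, contradicting cos^2 + sin^2 = 1. *)
Lemma sin_ge_quarter (x : R) : 0 <= x <= pi / 2 -> x / 4 <= sin x.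
Proof.
move=> /andP[x0 xpi].
case: (ltgtP 0 x) x0 => // [x0 _|<- _]; last by rewrite sin0 mul0r.
have pi4 : pi <= 4 :> R by have := pihalf_02 R; lra.
rewrite leNgt; apply/negP => sinx.
have dsin c : c \in `]0, x[ -> is_derive c 1 sin (cos c).
  by move=> _; exact: is_derive_sin.
case: (MVT x0 dsin) => [|c].
  exact/continuous_subspaceT/continuous_sin.
rewrite in_itv /= => /andP[c0 cx].
rewrite sin0 !subr0 => sinxE.
have sc : sin c < sin x by rewrite ltr_sin ?in_itv //=; lra.
have sc0 : 0 <= sin c by apply: sin_ge0_pi; lra.
have cc0 : 0 <= cos c by apply: cos_ge0_pihalf; lra.
have := cos2Dsin2 c; have : cos c < 1 / 4 by rewrite sinxE in sinx; nra.
nra.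
Qed.

(** With w = t - m, |1 - e(t)| = 2 |sin(pi w)| >= pi |w| / 2, and pi >= 2. *)
Lemma normc_1Be_ge t (m : int) : `|t - m%:~R| <= 2^-1 ->
  `|t - m%:~R| <= normc (1 - e t).
Proof.
set w := t - m%:~R => w2.
have -> : e t = e w by rewrite /w eD -mulrNz e_int mulr1.
have -> : normc (1 - e w) = 2 * `|sin (pi * w)|.
  rewrite /e /= (_ : 2 * pi * w = (pi * w) *+ 2); last by rewrite -mulrA mulr_natl.
  rewrite cos_mulr2n sin_mulr2n.
  apply/eqP; rewrite -(@eqrXn2 _ 2) ?sqrtr_ge0 ?mulr_ge0 //.
  rewrite sqr_sqrtr ?addr_ge0 ?sqr_ge0 // exprMn real_normK ?num_real //.
  have := cos2Dsin2 (pi * w); set c := cos _; set s := sin _ => cs.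
  have -> : c ^+ 2 = 1 - s ^+ 2 by lra.
  rewrite sub0r sqrrN !mulr2n -mulrDl exprMn.
  have -> : (c + c) ^+ 2 = 4 * (1 - s ^+ 2) by rewrite -[s ^+ 2](addKr (c ^+ 2)) cs; ring.
  by apply/eqP; ring.
have -> : `|sin (pi * w)| = `|sin (pi * `|w|)|.
  by case: (ler0P w) => // _; rewrite mulrN sinN normrN.
have pi2 := pi_ge2 R.
have := @sin_ge_quarter (pi * `|w|).
have w0 := normr_ge0 w.
have -> : 0 <= pi * `|w| <= pi / 2 by apply/andP; split; nra.
move=> /(_ isT) h; have := ler_norm (sin (pi * `|w|)); nra.
Qed.

(** Multiplication by 1 - e(b) makes the geometric sum telescope. The product form also covers
    integral b, where there is nothing to divide by. *)
Lemma sum_e_linear_le (b c : R) (A B : nat) :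
  normc (\sum_(A <= u < B) e (b * u%:R + c)) * normc (1 - e b) <= 2.
Proof.
case: (leqP A B) => [AB|/ltnW BA]; last first.
  by rewrite big_geq // ComplexField.Normc.normc0 mul0r.
rewrite -ComplexField.Normc.normcM mulr_suml.
rewrite (eq_bigr (fun u => - (e (b * u.+1%:R + c) - e (b * u%:R + c)))); last first.
  move=> u _; rewrite mulrBr mulr1 -eD opprB; congr (_ - e _).
  by rewrite -natr1; ring.
rewrite sumrN normcN telescope_sumr //.
by apply: le_trans (le_normcD _ _) _; rewrite normcN !normc_e; lra.
Qed.

End ExponentialSums.

(** * Correlations of sequences and the first Cauchy inequality *)

Section Correlations.
Context {R : realType}.

(** The substitution v = u + h: passing from L to L + 1 adds to the inner sum of each h the single
    pair (L, L - h). *)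
Lemma sum_below_diagonal (V : nmodType) (G : nat -> nat -> V) (L : nat) :
  \sum_(0 <= v < L) \sum_(0 <= u < v) G v u =
  \sum_(1 <= h < L) \sum_(0 <= u < L - h) G (u + h)%N u.
Proof.
elim: L => [|L IH]; first by rewrite !big_geq.
rewrite big_nat_recr //= IH.
rewrite [RHS](eq_big_nat _ _ (F2 := fun h =>
  \sum_(0 <= u < L - h) G (u + h)%N u + G L (L - h)%N)); last first.
  by move=> h /andP[_ hL]; rewrite subSn // big_nat_recr //= subnK.
rewrite big_split /=; congr (_ + _).
  case: L {IH} => [|L]; first by rewrite !big_geq.
  by rewrite [RHS]big_nat_recr //= subnn [X in _ = _ + X]big_geq // addr0.
rewrite big_nat_rev /= add0n big_add1 /=.
by apply: eq_big_nat => u /andP[_ uL].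
Qed.

Lemma conjcM (z w : R[i]) : conjc (z * w) = conjc z * conjc w.
Proof. exact: rmorphM. Qed.

Lemma Re_sum (I : Type) (r : seq I) (P : pred I) (F : I -> R[i]) :
  complex.Re (\sum_(i <- r | P i) F i) = \sum_(i <- r | P i) complex.Re (F i).
Proof. by apply: (big_morph (@complex.Re R)) => // -[a b] [c d]. Qed.

Lemma sqr_normcD (z w : R[i]) :
  normc (z + w) ^+ 2 = normc z ^+ 2 + normc w ^+ 2 + 2 * complex.Re (w * conjc z).
Proof.
rewrite !sqr_normc_Re; case: z => a b; case: w => c d /=; ring.
Qed.

Lemma sqr_normc_sum (F : nat -> R[i]) (L : nat) :
  normc (\sum_(0 <= u < L) F u) ^+ 2 =
  \sum_(0 <= u < L) normc (F u) ^+ 2 +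
  2 * \sum_(1 <= h < L) complex.Re (\sum_(0 <= u < L - h) F (u + h)%N * conjc (F u)).
Proof.
rewrite (eq_bigr _ (fun h _ => Re_sum _ _ _ _)).
rewrite -(sum_below_diagonal _ (fun v u => complex.Re (F v * conjc (F u)))).
elim: L => [|L IH].
  by rewrite !big_geq // mulr0 addr0 ComplexField.Normc.normc0 expr0n.
rewrite !big_nat_recr //= sqr_normcD IH.
have -> : complex.Re (F L * conjc (\sum_(0 <= u < L) F u)) =
    \sum_(0 <= u < L) complex.Re (F L * conjc (F u)).
  by rewrite rmorph_sum mulr_sumr Re_sum.
by ring.
Qed.

Lemma sqr_normc_sum_le (F : nat -> R[i]) (L : nat) :
  (forall u, normc (F u) <= 1) ->
  normc (\sum_(0 <= u < L) F u) ^+ 2 <= L%:R +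
  2 * \sum_(1 <= h < L) normc (\sum_(0 <= u < L - h) F (u + h)%N * conjc (F u)).
Proof.
move=> F1; rewrite sqr_normc_sum; apply: lerD.
  apply: (@le_trans _ _ (\sum_(0 <= u < L) 1)).
    by apply: ler_sum => u _; rewrite exprn_ile1 ?normc_ge0.
  by rewrite big_const_nat subn0 iter_addr_0.
by rewrite ler_wpM2l //; apply: ler_sum => h _; exact: Re_le_normc.
Qed.

(** The phase is conj(z) / |z|, or 0 when z = 0, whence only |c| <= 1. *)
Lemma exists_phase (z : R[i]) :
  exists2 c : R[i], normc c <= 1 & complex.Re (c * z) = normc z.
Proof.
have [->|z0] := eqVneq z 0.
  by exists 0; rewrite ComplexField.Normc.normc0 // mulr0.
have nz : normc z != 0 by apply: contra_neq z0; exact: ComplexField.Normc.eq0_normc.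
exists (conjc z * ((normc z)^-1)%:C%C).
  rewrite ComplexField.Normc.normcM normc_conj /= expr0n addr0 sqrtr_sqr.
  by rewrite ger0_norm ?invr_ge0 ?normc_ge0 // divff.
have -> : conjc z * ((normc z)^-1)%:C%C * z = ((normc z)^-1)%:C%C * (z * conjc z).
  by rewrite mulrC mulrA mulrC.
have -> : complex.Re (((normc z)^-1)%:C%C * (z * conjc z)) =
          (normc z)^-1 * complex.Re (z * conjc z).
  by case: (z * conjc z) => a b /=; rewrite mul0r subr0.
by rewrite -sqr_normc_Re expr2 mulKf.
Qed.

(* Linearising the moduli with phases and applying Cauchy's inequality in u
   discards the condition [P u], leaving complete sums over u. *)
Lemma sqr_sum_normc_le (phi : nat -> R) (P : pred nat) (K y A : nat) :
  (\sum_(1 <= k < K.+1) normc (\sum_(A <= u < A + y | P u) e (k%:R * phi u))) ^+ 2 <=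
  y%:R * K%:R * (y%:R +
    2 * \sum_(1 <= h < K) normc (\sum_(A <= u < A + y) e (h%:R * phi u))).
Proof.
pose S k := \sum_(A <= u < A + y | P u) e (k%:R * phi u).
have [c c1 cS] : exists2 c : nat -> R[i], forall k, normc (c k) <= 1 &
    forall k, complex.Re (c k * S k) = normc (S k).
  have /choice[c cP] k : exists c, normc c <= 1 /\ complex.Re (c * S k) = normc (S k).
    by have [c] := exists_phase (S k); exists c.
  by exists c => k; have [] := cP k.
pose F u k := c k.+1 * e (k.+1%:R * phi u).
pose W u := \sum_(0 <= k < K) F u k.
have F1 u k : normc (F u k) <= 1 by rewrite ComplexField.Normc.normcM normc_e mulr1.
have VW : \sum_(1 <= k < K.+1) normc (S k) <= \sum_(A <= u < A + y) normc (W u).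
  apply: (@le_trans _ _ (\sum_(A <= u < A + y | P u) normc (W u))); last first.
    rewrite big_mkcond; apply: ler_sum => u _.
    by case: ifP => // _; exact: normc_ge0.
  apply: le_trans (normc_sum _ _ _ _); apply: le_trans (Re_le_normc _).
  rewrite exchange_big big_add1 Re_sum /=; apply: ler_sum => k _.
  by rewrite -cS mulr_sumr.
apply: (@le_trans _ _ ((\sum_(A <= u < A + y) normc (W u)) ^+ 2)).
  by apply: lerXn2r; rewrite ?nnegrE ?sumr_ge0 // => k _; exact: normc_ge0.
apply: le_trans (sqr_sum_le _ _ _) _.
rewrite size_iota addKn -mulrA ler_wpM2l //.
have -> : \sum_(A <= u < A + y) normc (W u) ^+ 2 =
    \sum_(A <= u < A + y) \sum_(0 <= k < K) normc (F u k) ^+ 2 +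
    2 * \sum_(1 <= h < K) complex.Re (\sum_(0 <= k < K - h)
          \sum_(A <= u < A + y) F u (k + h)%N * conjc (F u k)).
  rewrite (eq_bigr _ (fun u _ => sqr_normc_sum (F u) K)) big_split /=.
  congr (_ + _); rewrite -mulr_sumr exchange_big /=; congr (_ * _).
  by apply: eq_bigr => h _; rewrite exchange_big /= Re_sum.
rewrite mulrDr; apply: lerD.
  apply: (@le_trans _ _ (\sum_(A <= u < A + y) \sum_(0 <= k < K) 1)).
    apply: ler_sum => u _; apply: ler_sum => k _.
    by rewrite exprn_ile1 ?normc_ge0.
  by rewrite !big_const_nat subn0 addKn !iter_addr_0 mulr_natr.
rewrite mulrCA ler_wpM2l // mulr_sumr; apply: ler_sum => h _.
apply: le_trans (Re_le_normc _) _; apply: le_trans (normc_sum _ _ _ _) _.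
set T := normc (\sum_(A <= u < A + y) e (h%:R * phi u)).
have T0 : 0 <= T by exact: normc_ge0.
apply: (@le_trans _ _ (\sum_(0 <= k < K - h) T)); last first.
  rewrite big_const_nat subn0 iter_addr_0 -[_ *+ (K - h)]mulr_natl ler_wpM2r // ler_nat.
  exact: leq_subr.
apply: ler_sum => k _.
(* The phases do not depend on u, and the frequencies differ by h whatever k is: each correlation is
   at most the same complete sum [T]. *)
rewrite (eq_bigr (fun u => c (k + h).+1 * conjc (c k.+1) * e (h%:R * phi u))).
  rewrite -mulr_sumr !ComplexField.Normc.normcM normc_conj ler_piMl //.
  by rewrite mulr_ile1 ?normc_ge0.
move=> u _; rewrite /F conjcM -eN.
rewrite mulrACA -eD; congr (_ * e _).
by rewrite -!natr1 natrD; ring.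
Qed.

End Correlations.

(** * Weyl differencing *)

Section WeylDifferencing.
Context {R : realType}.

(** Taylor's formula with divided (Hasse) derivatives; only the first of them reaches degree [d],
    which gives the leading coefficient. *)
Lemma exists_difference_poly (p : {poly R}) (d : nat) (h : R) :
  (size p <= d.+2)%N ->
  exists r : {poly R}, [/\ (size r <= d.+1)%N, r`_d = d.+1%:R * h * p`_d.+1 &
    forall x, r.[x] = p.[x + h] - p.[x]].
Proof.
move=> sp; exists (\sum_(i < d.+1) h ^+ i.+1 *: p^`N(i.+1)).
have coefr j : (\sum_(i < d.+1) h ^+ i.+1 *: p^`N(i.+1))`_j =
    \sum_(i < d.+1) h ^+ i.+1 * (p`_(i.+1 + j) *+ 'C(i.+1 + j, i.+1)).
  by rewrite coef_sum; apply: eq_bigr => i _; rewrite coefZ coef_nderivn.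
split.
- apply/leq_sizeP => j dj; rewrite coefr big1 // => i _.
  by rewrite nth_default ?mul0rn ?mulr0 // (leq_trans sp) //; lia.
- rewrite coefr big_ord_recl big1 => [|i _]; last first.
    by rewrite nth_default ?mul0rn ?mulr0 // (leq_trans sp) //= /bump; lia.
  by rewrite addr0 expr1 add1n bin1 -mulr_natl; ring.
- move=> x; rewrite (@nderiv_taylor_wide _ d.+2) //; last exact: mulrC.
  rewrite [in RHS]big_ord_recl /= nderivn0 expr0 mulr1 addrC addKr horner_sum.
  by apply: eq_bigr => i _; rewrite hornerZ mulrC.
Qed.

(* The smooth form of min(y, 1/|1 - e(t)|): since a sum S of y terms e(t u) has
   |S| <= y and |S| |1 - e(t)| <= 2, it satisfies |S| (2 + y |1 - e(t)|) <= 4 y. *)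
Definition lin_bound (y t : R) : R := 4 * y / (2 + y * normc (1 - e t)).

Lemma lin_bound_ge0 (y t : R) : 0 <= y -> 0 <= lin_bound y t.
Proof.
by move=> y0; rewrite divr_ge0 ?mulr_ge0 ?addr_ge0 ?mulr_ge0 ?normc_ge0.
Qed.

Lemma normc_sum_e_le (L : nat) (phi : nat -> R) :
  normc (\sum_(0 <= u < L) e (phi u)) <= L%:R.
Proof.
apply: le_trans (normc_sum _ _ _ _) _.
under eq_bigr do rewrite normc_e.
by rewrite big_const_nat subn0 iter_addr_0.
Qed.

Lemma sum_e_lin_bound (b c : R) (L y : nat) : (L <= y)%N ->
  normc (\sum_(0 <= u < L) e (b * u%:R + c)) <= lin_bound y%:R b.
Proof.
move=> Ly; have S0 := @normc_ge0 R (\sum_(0 <= u < L) e (b * u%:R + c)).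
have v0 := @normc_ge0 R (1 - e b).
have Sy := normc_sum_e_le L (fun u => b * u%:R + c).
have Sv := sum_e_linear_le b c 0 L.
have Ly' : L%:R <= y%:R :> R by rewrite ler_nat.
have y0 : 0 <= y%:R :> R by [].
rewrite /lin_bound ler_pdivlMr; last by nra.
by move: (normc (\sum_(0 <= u < L) _)) (normc (1 - _)) S0 v0 Sy Sv => S v; nra.
Qed.

(** Unfolded, this sums [lin_bound] at (s+1)! h_1 ... h_s b over all shifts h_i <= y. Each
    differencing multiplies the leading coefficient by the current degree and the shift. *)
Fixpoint weyl_sum (y s : nat) (b : R) : R :=
  if s is s'.+1 then \sum_(1 <= h < y.+1) weyl_sum y s' (s'.+2%:R * h%:R * b)
  else lin_bound y%:R b.

Lemma weyl_sum_ge0 (y s : nat) (b : R) : 0 <= weyl_sum y s b.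
Proof.
elim: s b => [|s IH] b; first exact: lin_bound_ge0.
by apply: sumr_ge0 => h _; exact: IH.
Qed.

(** Weyl's bound y^(2^s - 1) + y^(2^s - s - 1) [weyl_sum] for the 2^s-th power, multiplied by
    y^(s+1). Uniformity in [p] and in [L <= y] lets the induction hypothesis apply to the
    differenced polynomials on their shortened ranges. *)
Lemma weyl_inequality (s : nat) : exists2 C : R, 1 <= C &
  forall (p : {poly R}) (x : R) (L y : nat),
  (size p <= s.+2)%N -> (L <= y)%N -> (0 < y)%N ->
  y%:R ^+ s.+1 * normc (\sum_(0 <= u < L) e p.[x + u%:R]) ^+ (2 ^ s) <=
  C * (y%:R ^+ (2 ^ s + s) + y%:R ^+ (2 ^ s) * weyl_sum y s p`_s.+1).
Proof.
elim: s => [|s [C C1 IH]].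
  exists 1 => // p x L y sp Ly y0.
  rewrite !expr1 mul1r -[leLHS]add0r lerD // ler_wpM2l //.
  rewrite (eq_bigr (fun u => e (p`_1 * u%:R + (p`_1 * x + p`_0)))).
    exact: sum_e_lin_bound.
  move=> u _; congr e; rewrite (@horner_coef_wide _ 2) //.
  by rewrite !big_ord_recl big_ord0 expr0 expr1 /=; ring.
(* The power of 4 comes from raising y + 2 sum T_h to the power 2^s; the summand 1 pays for its
   diagonal part. *)
exists (4 ^+ (2 ^ s) * (C + 1)).
  by rewrite mulr_ege1 ?exprn_ege1 //; lra.
move=> p x L y sp Ly y0.
have yR0 : 0 < y%:R :> R by rewrite ltr0n.
have yR1 : 1 <= y%:R :> R by rewrite ler1n.
set N := (2 ^ s)%N.
have N0 : (0 < N)%N by rewrite expn_gt0.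
pose T h := normc (\sum_(0 <= u < L - h)
              e p.[x + (u + h)%:R] * conjc (e p.[x + u%:R])).
have T0 h : 0 <= T h by exact: normc_ge0.
set S := normc _.
have S0 : 0 <= S by exact: normc_ge0.
have S2 : S ^+ 2 <= y%:R + 2 * \sum_(1 <= h < y.+1) T h.
  apply: le_trans (sqr_normc_sum_le (fun u => e p.[x + u%:R]) L _) _.
    by move=> u; rewrite normc_e.
  rewrite lerD ?ler_nat // ler_wpM2l //.
  by apply: ler_sum_index_iota => //; rewrite leqW.
have TN h : (1 <= h < y.+1)%N -> y%:R ^+ s.+1 * T h ^+ N <=
    C * (y%:R ^+ (N + s) + y%:R ^+ N * weyl_sum y s (s.+2%:R * h%:R * p`_s.+2)).
  move=> /andP[h1 hy].
  have [r [sr rs rE]] := exists_difference_poly p s.+1 h%:R sp.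
  have := IH r x (L - h)%N y sr (leq_trans (leq_subr _ _) Ly) y0; rewrite rs.
  apply: le_trans; rewrite ler_wpM2l ?exprn_ge0 ?(ltW yR0) //.
  rewrite /T (eq_bigr (fun u => e r.[x + u%:R])) // => u _.
  by rewrite rE -eN -eD natrD addrA.
have sumTN : y%:R * (\sum_(1 <= h < y.+1) T h) ^+ N <=
             y%:R ^+ N * \sum_(1 <= h < y.+1) T h ^+ N.
  by apply: sum_pow2_le => //; rewrite size_iota subn1.
have SN : S ^+ (2 ^ s.+1) <=
    4 ^+ N * (y%:R ^+ N + (\sum_(1 <= h < y.+1) T h) ^+ N).
  rewrite expnS exprM -/N.
  have := @lerXn2r _ N (S ^+ 2) (y%:R + 2 * \sum_(1 <= h < y.+1) T h).
  rewrite !nnegrE exprn_ge0 // addr_ge0 ?mulr_ge0 ?sumr_ge0 //.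
  move=> /(_ isT isT S2) /le_trans; apply.
  apply: le_trans (exprD_le _ _ _ _ _) _; rewrite ?mulr_ge0 ?sumr_ge0 //.
  rewrite exprMn (_ : 4 = 2 * 2 :> R) ?exprMn -?mulrA; last by ring.
  rewrite ler_wpM2l ?exprn_ge0 // mulrDr lerD // ler_peMl ?exprn_ge0 //.
  by rewrite exprn_ege1 //; lra.
rewrite [weyl_sum _ _ _]/=; set WS := \sum_(1 <= h < y.+1) weyl_sum _ _ _.
have sumTN' : y%:R ^+ s.+1 * \sum_(1 <= h < y.+1) T h ^+ N <=
    C * (y%:R ^+ (N + s).+1 + y%:R ^+ N * WS).
  rewrite mulr_sumr; apply: le_trans (ler_sum_nat TN) _.
  rewrite -mulr_sumr big_split /= -mulr_sumr big_const_nat subn1 iter_addr_0.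
  by rewrite exprS mulr_natl.
have e1 : y%:R ^+ s.+2 * (\sum_(1 <= h < y.+1) T h) ^+ N <=
    C * (y%:R ^+ (N + N + s.+1) + y%:R ^+ (N + N) * WS).
  rewrite exprSr -mulrA.
  apply: le_trans (ler_wpM2l (exprn_ge0 _ (ltW yR0)) sumTN) _.
  rewrite mulrCA.
  apply: le_trans (ler_wpM2l (exprn_ge0 _ (ltW yR0)) sumTN') _.
  by rewrite mulrCA mulrDr mulrA -!exprD addnS addnA addnS.
have e2 : y%:R ^+ s.+2 * y%:R ^+ N <= y%:R ^+ (N + N + s.+1) :> R.
  by rewrite -exprD ler_weXn2l //; lia.
have -> : (2 ^ s.+1 = N + N)%N by rewrite expnS mul2n addnn.
rewrite expnS mul2n -addnn -/N in SN.
have WS0 : 0 <= WS by apply: sumr_ge0 => h _; exact: weyl_sum_ge0.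
apply: le_trans (ler_wpM2l (exprn_ge0 _ (ltW yR0)) SN) _.
rewrite mulrCA -mulrA ler_wpM2l ?exprn_ge0 // mulrDr mulrDl [leRHS]addrC mul1r.
apply: lerD => //; apply: le_trans e2 _; rewrite lerDl mulr_ge0 ?exprn_ge0 //.
Qed.

(** The products j h_1 ... h_s are collected into m, and a given m arises from at most [tau s m]
    tuples. *)
Lemma sum_weyl_sum_le (y s J : nat) (b : R) :
  \sum_(1 <= j < J.+1) weyl_sum y s (j%:R * b) <=
  \sum_(1 <= m < (J * y ^ s).+1)
     (tau s m)%:R * lin_bound y%:R (((s.+1)`! * m)%:R * b).
Proof.
elim: s b => [|s IH] b.
  by rewrite muln1; apply: ler_sum => j _; rewrite mul1r mul1n.
rewrite exchange_big /=.
pose F h m := (tau s m)%:R * lin_bound y%:R ((s.+2`! * (h * m))%:R * b).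
apply: (@le_trans _ _ (\sum_(1 <= h < y.+1) \sum_(1 <= m < (J * y ^ s).+1) F h m)).
  apply: ler_sum => h _.
  under eq_bigr do rewrite mulrCA.
  apply: le_trans (IH _) _; apply: ler_sum => m _; rewrite /F.
  rewrite (_ : _ * (_ * b) = (s.+2`! * (h * m))%:R * b) //.
  by rewrite factS !natrM; ring.
rewrite expnS mulnCA.
apply: le_trans (sum_mul_le_divisor_sum _ _ _ _ _) _.
  by move=> h m; rewrite mulr_ge0 // lin_bound_ge0.
apply: ler_sum_nat => m _; rewrite /= natr_sum mulr_suml.
by apply: ler_sum => h hm; rewrite /F [(h * _)%N]mulnC divnK.
Qed.

End WeylDifferencing.

(** * Sums over multiples of a rational approximation *)

Section RationalApproximation.
Context {R : realType}.

(** The square of [lin_bound] with |1 - e(t)| replaced by l / q, cleared of the inner fraction. *)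
Definition residue_bound (y q : R) (l : nat) : R :=
  16 * y ^+ 2 * q ^+ 2 / (2 * q + y * l%:R) ^+ 2.

Lemma residue_bound_ge0 (y q : R) (l : nat) : 0 <= residue_bound y q l.
Proof.
by apply: divr_ge0; rewrite ?sqr_ge0 //; do 2!(apply: mulr_ge0; rewrite ?sqr_ge0 //).
Qed.

(* The (l+1)-st term is at most f(l) - f(l+1), f(l) = 16 y q^2 / (2 q + y l). *)
Lemma sum_residue_bound_le (y q : R) (n : nat) : 0 < y -> 0 < q ->
  \sum_(0 <= l < n) residue_bound y q l <= 4 * y ^+ 2 + 8 * y * q.
Proof.
move=> y0 q0.
pose f l : R := 16 * y * q ^+ 2 / (2 * q + y * l%:R).
have d0 l : 0 < 2 * q + y * l%:R by rewrite ltr_pwDl ?mulr_ge0 ?mulr_gt0 // ltW.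
have f0 l : 0 <= f l by rewrite divr_ge0 ?ltW ?mulr_gt0 ?exprn_gt0.
have f00 : f 0%N = 8 * y * q by rewrite /f; field; lra.
suff : \sum_(0 <= l < n.+1) residue_bound y q l <= 4 * y ^+ 2 + (f 0%N - f n).
  rewrite f00; have := f0 n; rewrite big_nat_recr //=.
  by have := residue_bound_ge0 y q n; lra.
elim: n => [|n IH].
  rewrite big_nat1 /residue_bound subrr addr0 le_eqVlt; apply/orP; left.
  by apply/eqP; field; lra.
rewrite big_nat_recr //=.
suff : residue_bound y q n.+1 <= f n - f n.+1 by lra.
have -> : f n - f n.+1 =
    16 * y ^+ 2 * q ^+ 2 / ((2 * q + y * n%:R) * (2 * q + y * n.+1%:R)).
  have := d0 n; have := d0 n.+1; rewrite /f -natr1 => d1 d2.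
  by field; apply/andP; split; lra.
rewrite /residue_bound ler_wpM2l ?mulr_ge0 ?exprn_ge0 ?(ltW y0) ?(ltW q0) //.
rewrite lef_pV2 ?posrE ?mulr_gt0 //.
by rewrite expr2 ler_wpM2r ?(ltW (d0 _)) // lerD2l ler_wpM2l ?(ltW y0) // ler_nat.
Qed.

(** Truncated subtraction makes l = 0, 1, 2 all give the term at 0, so two copies of 4 y^2 are added
    to the unshifted bound. *)
Lemma sum_residue_bound_shift_le (y q : R) (n : nat) : 0 < y -> 0 < q ->
  \sum_(0 <= l < n) residue_bound y q (l - 2) <= 12 * (y ^+ 2 + y * q).
Proof.
move=> y0 q0.
have b0 := residue_bound_ge0 y q.
have b00 : residue_bound y q 0%N = 4 * y ^+ 2 by rewrite /residue_bound; field; lra.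
apply: (@le_trans _ _ (\sum_(0 <= l < n.+2) residue_bound y q (l - 2))).
  by apply: ler_sum_index_iota => //; rewrite !leqW.
rewrite !big_nat_recl //= !sub0n b00.
under eq_bigr do rewrite subn2 /=.
by have := sum_residue_bound_le y q n y0 q0; nra.
Qed.

(** Modulo 1, t is s / q up to 2 / q, so its distance to the nearest integer [m] is at least (s - 2)
    / q or (q - s - 2) / q, according to the side of t on which [m] lies. *)
Lemma normc_1Be_near_rational (q : nat) (c : int) (delta t : R) :
  (0 < q)%N -> `|delta| <= 2 -> q%:R * t = c%:~R + delta ->
  let s := `|(c %% q%:Z)%Z|%N in
  (s - 2)%:R / q%:R <= normc (1 - e t) \/ (q - s - 2)%:R / q%:R <= normc (1 - e t).
Proof.
move=> q0 delta2 qt s.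
have qR0 : 0 < q%:R :> R by rewrite ltr0n.
pose m := Num.floor (t + 2^-1).
have /andP[m1 m2] := floor_itv (t + 2^-1); rewrite -/m intrD in m1 m2.
have tm : `|t - m%:~R| <= 2^-1 by rewrite ler_norml; apply/andP; split; lra.
have := normc_1Be_ge t m tm; set v := normc _ => tv.
have v0 : 0 <= v by exact: normc_ge0.
have sE : (s%:Z = c %% q%:Z)%Z by rewrite gez0_abs // modz_ge0 //; lia.
have sq : (s < q)%N by have := ltz_pmod c (_ : (0 < q%:Z)%R); lia.
pose d := (c %/ q%:Z)%Z.
have cE : c = d * q%:Z + s%:Z by rewrite sE -divz_eq.
have qtm : q%:R * (t - m%:~R) = (d - m)%:~R * q%:R + s%:R + delta.
  by rewrite mulrBr qt cE !intrD intrM mulrNz; ring.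
have qv : `|q%:R * (t - m%:~R)| <= q%:R * v.
  by rewrite normrM ger0_norm ?ler_wpM2l // ltW.
move: delta2 qv; rewrite qtm !ler_norml => /andP[dl1 dl2] /andP[qv1 qv2].
case: (lerP m d) => md; [left|right].
  rewrite ler_pdivrMr // mulrC.
  case: (leqP s 2) => s2; first by rewrite (eqP (_ : s - 2 == 0)%N) ?mulr_ge0 // ltW.
  rewrite natrB ?(ltnW s2) //.
  have : 0 <= (d - m)%:~R :> R by rewrite ler0z subr_ge0.
  by nra.
rewrite ler_pdivrMr // mulrC.
case: (leqP (q - s) 2) => s2; first by rewrite (eqP (_ : q - s - 2 == 0)%N) ?mulr_ge0 // ltW.
rewrite natrB ?(ltnW s2) // natrB ?(ltnW sq) //.
have : (d - m)%:~R <= (-1)%:~R :> R by rewrite ler_int; lia.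
rewrite mulrN1z.
by nra.
Qed.

(** Up to a bounded error, q alpha (m0 + r) is the integer c + a r, which runs through every residue
    modulo q once since a is coprime to q. The two one-sided bounds contribute 12 each. *)
Lemma sum_lin_bound_block_le (a : int) (theta alpha y : R) (q m0 : nat) :
  (0 < q)%N -> 0 < y -> coprimez a q%:Z -> `|theta| <= 1 ->
  alpha = a%:~R / q%:R + theta / q%:R ^+ 2 ->
  \sum_(0 <= r < q) lin_bound y (alpha * (m0 + r)%:R) ^+ 2 <=
  24 * (y ^+ 2 + y * q%:R).
Proof.
move=> q0 y0 aq theta1 alphaE.
have qR0 : 0 < q%:R :> R by rewrite ltr0n.
pose c := Num.floor (q%:R * (alpha * m0%:R)).
have /andP[c1 c2] := floor_itv (q%:R * (alpha * m0%:R)); rewrite -/c intrD in c1 c2.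
pose s (r : nat) := `|((c + a * r%:Z) %% q%:Z)%Z|%N.
have sE (r : nat) : ((c + a * r%:Z) %% q%:Z)%Z = (s r)%:Z.
  by rewrite /s gez0_abs // modz_ge0 //; lia.
have sq r : (s r < q)%N.
  have := ltz_pmod (c + a * r%:Z) (_ : (0 < q%:Z)%R).
  have := modz_ge0 (c + a * r%:Z) (_ : q%:Z != 0); rewrite /s; lia.
have Gle (r : nat) : (r < q)%N -> lin_bound y (alpha * (m0 + r)%:R) ^+ 2 <=
    residue_bound y q%:R (s r - 2) + residue_bound y q%:R (q - s r - 2).
  move=> rq.
  have b0 := residue_bound_ge0 y q%:R.
  have Gb l : l%:R / q%:R <= normc (1 - e (alpha * (m0 + r)%:R)) ->
      lin_bound y (alpha * (m0 + r)%:R) ^+ 2 <= residue_bound y q%:R l.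
    rewrite /lin_bound; set v := normc _ => lv.
    have v0 : 0 <= v by exact: normc_ge0.
    have -> : residue_bound y q%:R l = (4 * y / (2 + y * (l%:R / q%:R))) ^+ 2.
      have l0 : 0 <= y * l%:R by rewrite mulr_ge0 ?(ltW y0).
      by rewrite /residue_bound; field; apply/andP; split; lra.
    have l0 : 0 <= y * (l%:R / q%:R) by rewrite mulr_ge0 ?divr_ge0 ?(ltW y0).
    have yv : y * (l%:R / q%:R) <= y * v by rewrite ler_wpM2l // ltW.
    have yv0 : 0 <= y * v by exact: le_trans yv.
    apply: lerXn2r; rewrite ?nnegrE ?divr_ge0 ?addr_ge0 ?mulr_ge0 ?(ltW y0) //.
    by rewrite ler_wpM2l ?mulr_ge0 ?(ltW y0) // lef_pV2 ?posrE; lra.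
  have [delta dE] : exists2 delta : R, `|delta| <= 2 &
      q%:R * (alpha * (m0 + r)%:R) = (c + a * r%:Z)%:~R + delta.
    (* A fractional part plus theta r / q, each at most 1 in modulus. *)
    exists (q%:R * (alpha * m0%:R) - c%:~R + theta * (r%:R / q%:R)).
      have rq1 : r%:R / q%:R <= 1 :> R by rewrite ler_pdivrMr // mul1r ler_nat ltnW.
      have rq0 : 0 <= r%:R / q%:R :> R by rewrite divr_ge0.
      move: theta1; rewrite !ler_norml => /andP[t1 t2].
      by apply/andP; split; nra.
    by rewrite intrD intrM natrD mulrDr [alpha in alpha * r%:R]alphaE; field; lra.
  move=> dE2; have [] := normc_1Be_near_rational _ _ _ _ q0 dE dE2.
  - by move=> /Gb; have := b0 (q - s r - 2)%N; lra.
  - by move=> /Gb; have := b0 (s r - 2)%N; lra.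
rewrite big_mkord.
apply: le_trans (ler_sum _ (fun (r : 'I_q) _ => Gle r (ltn_ord r))) _.
pose h (r : 'I_q) : 'I_q := Ordinal (sq r).
have h_inj : injective h.
  move=> r r' /(congr1 val) /= rr'; apply: val_inj => /=.
  have : (c + a * r%:Z == c + a * r'%:Z %[mod q%:Z])%Z.
    by rewrite !sE rr'.
  rewrite eqz_mod_dvd (_ : _ - _ = a * (r%:Z - r'%:Z)); last by ring.
  rewrite Gauss_dvdzr; last by rewrite coprimez_sym.
  move=> /dvdzP[k kE].
  move: (ltn_ord r) (ltn_ord r') kE; move: (nat_of_ord r) (nat_of_ord r').
  move=> {r r' rr'} r r' rq r'q kE.
  have [k0|k0|k0] := ltgtP k 0; last by move: kE; rewrite k0 mul0r; lia.
  - have : (k + 1) * q%:Z <= 0 by rewrite pmulr_lle0 //; lia.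
    by rewrite mulrDl -kE; lia.
  - have : 0 <= (k - 1) * q%:Z by rewrite mulr_ge0 //; lia.
    by rewrite mulrBl -kE; lia.
pose F (i : 'I_q) : R := residue_bound y q%:R (i - 2) + residue_bound y q%:R (q - i - 2).
rewrite (_ : \sum_r _ = \sum_(r : 'I_q) F (h r)) // -(reindex_inj h_inj (P := predT)).
rewrite big_split /=.
have -> : 24 * (y ^+ 2 + y * q%:R) =
    12 * (y ^+ 2 + y * q%:R) + 12 * (y ^+ 2 + y * q%:R) :> R by ring.
rewrite -!(big_mkord predT (fun i => residue_bound y q%:R (i - 2))).
rewrite lerD ?sum_residue_bound_shift_le //.
rewrite -(big_mkord predT (fun i => residue_bound y q%:R (q - i - 2))).
(* Reversal turns q - i into i + 1; adding the missing term at 0 gives a sum of q + 1 terms. *)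
apply: le_trans (sum_residue_bound_shift_le y q%:R q.+1 y0 qR0).
rewrite big_nat_rev add0n /= [leRHS]big_nat_recl //= ler_wpDl ?residue_bound_ge0 //.
apply: ler_sum_nat => i /andP[_ iq].
by rewrite subKn.
Qed.

Lemma sum_lin_bound_sqr_le (a : int) (theta alpha y : R) (q M : nat) :
  (0 < q)%N -> 0 < y -> coprimez a q%:Z -> `|theta| <= 1 ->
  alpha = a%:~R / q%:R + theta / q%:R ^+ 2 ->
  \sum_(1 <= m < M.+1) lin_bound y (alpha * m%:R) ^+ 2 <=
  24 * (M%:R / q%:R + 1) * (y ^+ 2 + y * q%:R).
Proof.
move=> q0 y0 aq theta1 alphaE.
have qR0 : 0 < q%:R :> R by rewrite ltr0n.
pose B := (M %/ q).+1.
have MB : (M < B * q)%N by rewrite ltn_ceil.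
apply: (@le_trans _ _ (\sum_(0 <= m < B * q) lin_bound y (alpha * m%:R) ^+ 2)).
  apply: le_trans (ler_sum_index_iota _ _ 0 M.+1 _ MB _); last by move=> m; exact: sqr_ge0.
  by rewrite [leRHS]big_ltn // lerDr sqr_ge0.
rewrite big_nat_mul.
apply: (@le_trans _ _ (\sum_(0 <= i < B) 24 * (y ^+ 2 + y * q%:R))).
  apply: ler_sum => i _; rewrite mulSn -{1}[(i * q)%N]add0n big_addn addnK.
  under eq_bigr do rewrite addnC.
  exact: (sum_lin_bound_block_le _ _ _ _ _ _ q0 y0 aq theta1 alphaE).
rewrite big_const_nat subn0 iter_addr_0 -[leLHS]mulr_natr mulrAC.
apply: ler_wpM2r; first by rewrite addr_ge0 ?sqr_ge0 ?mulr_ge0 ?(ltW y0).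
rewrite ler_wpM2l // /B -natr1 lerD2r ler_pdivlMr // -natrM ler_nat.
exact: leq_divM.
Qed.

End RationalApproximation.

(** * Mean values *)

Section MeanValue.
Context {R : realType}.

Lemma harmonic_sum_le (X : nat) : (0 < X)%N ->
  \sum_(1 <= m < X.+1) m%:R^-1 <= 1 + ln X%:R :> R.
Proof.
case: X => // X _; elim: X => [|X IH]; first by rewrite big_nat1 invr1 ln1 addr0.
rewrite big_nat_recr //=; apply: le_trans (lerD IH (lexx _)) _.
rewrite -addrA lerD2l -lerBrDl.
have X1 : 0 < X.+1%:R :> R by rewrite ltr0n.
have X2 : 0 < X.+2%:R :> R by rewrite ltr0n.
(* From ln(1 + t) <= t at t = -1/(X+2), one gets 1/(X+2) <= ln(X+2) - ln(X+1). *)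
have := @le_ln1Dx R (- X.+2%:R^-1).
rewrite ltrN2 invf_lt1 // ltr1n => /(_ isT).
rewrite (_ : 1 - X.+2%:R^-1 = X.+1%:R / X.+2%:R); last first.
  by have := ler0n R X; rewrite -!natr1 => ?; field; lra.
by rewrite ln_div ?posrE // lerNr opprB.
Qed.

Lemma sum_multiples_le (F : nat -> R) (c X : nat) : (0 < c)%N ->
  (forall m, 0 <= F m) ->
  \sum_(1 <= m < X.+1) F (c * m)%N <= \sum_(1 <= m < (c * X).+1) F m.
Proof.
move=> c0 F0; elim: X => [|X IH]; first by rewrite muln0 !big_geq.
rewrite big_nat_recr //= [leRHS]big_nat_recr ?muln_gt0 ?c0 //= lerD2r.
apply: le_trans IH _; apply: ler_sum_index_iota => //.
by rewrite mulnS -addn1 addnC leq_add.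
Qed.

(** Expanding the product, only 1/(k y^s) is not already on the right: it is at most 1/y if s > 0,
    and equals 1/k^(2^s) if s = 0. *)
Lemma error_terms_le (k y q : R) (s : nat) : 1 <= k -> 1 <= y -> 0 < q ->
  (q^-1 + (k * y ^+ s)^-1) * (1 + q / y) <=
  2 * (1 / q + 1 / y + q / (k * y ^+ s.+1) + 1 / k ^+ (2 ^ s)).
Proof.
move=> k1 y1 q0.
have [k0 y0] : 0 < k /\ 0 < y by split; lra.
have ys1 : 1 <= y ^+ s by rewrite exprn_ege1.
have ys0 : 0 < y ^+ s by lra.
have -> : (q^-1 + (k * y ^+ s)^-1) * (1 + q / y) =
    q^-1 + y^-1 + (k * y ^+ s)^-1 + q / (k * y ^+ s.+1).
  by rewrite exprS; field; rewrite !gt_eqF.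
have kN0 : 0 < k ^+ (2 ^ s) by rewrite exprn_gt0.
have : (k * y ^+ s)^-1 <= y^-1 + (k ^+ (2 ^ s))^-1.
  case: s ys1 ys0 kN0 => [|s] ys1 ys0 kN0.
    by rewrite expr0 mulr1 expn0 expr1 lerDr invr_ge0 ltW.
  apply: (@le_trans _ _ y^-1); last by rewrite lerDl invr_ge0 ltW.
  rewrite lef_pV2 ?posrE ?mulr_gt0 // -[leLHS]mul1r ler_pM ?(ltW y0) //.
  by rewrite exprS ler_peMr ?exprn_ege1 // ltW.
have : 0 < q / (k * y ^+ s.+1) by rewrite divr_gt0 ?mulr_gt0 ?exprn_gt0.
have : 0 < q^-1 by rewrite invr_gt0.
have : 0 < y^-1 by rewrite invr_gt0.
have : 0 < (k ^+ (2 ^ s))^-1 by rewrite invr_gt0.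
by rewrite !div1r; lra.
Qed.

(** In the constant, (s+1)! comes from enlarging the range from multiples of (s+1)! to all integers,
    the power of s + 2 from the harmonic sum, and 48 from the 24 of the block estimate and the 2 of
    [error_terms_le]. *)
Lemma sqr_sum_weyl_sum_le (s K x y q : nat) (alpha theta : R) (a : int) :
  (0 < K)%N -> (0 < y)%N -> (0 < q)%N -> (K <= y)%N -> (y < x)%N ->
  1 <= ln x%:R :> R ->
  alpha = a%:~R / q%:R + theta / q%:R ^+ 2 ->
  coprimez a q%:Z -> `|theta| <= 1 ->
  (\sum_(1 <= j < K) weyl_sum y s (j%:R * alpha)) ^+ 2 <=
  (48 * s.+1`!%:R * s.+2%:R ^+ (s.+1 ^ 2)) *
  (ln x%:R ^+ (s.+1 ^ 2) *
    (1 / q%:R + 1 / y%:R + q%:R / (K%:R * y%:R ^+ s.+1) + 1 / K%:R ^+ (2 ^ s))) *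
  (K%:R * y%:R ^+ s.+1) ^+ 2.
Proof.
move=> K0 y0 q0 Ky yx L1 alphaE aq theta1.
have qR0 : 0 < q%:R :> R by rewrite ltr0n.
have yR1 : 1 <= y%:R :> R by rewrite ler1n.
have yR0 : 0 < y%:R :> R by rewrite ltr0n.
have kR1 : 1 <= K%:R :> R by rewrite ler1n.
set X := (K * y ^ s)%N.
have X0 : (0 < X)%N by rewrite muln_gt0 K0 expn_gt0 y0.
have XR0 : 0 < X%:R :> R by rewrite ltr0n.
set L := ln x%:R in L1 *.
set c := s.+1`!.
have c0 : (0 < c)%N by exact: fact_gt0.
have c1 : 1 <= c%:R :> R by rewrite ler1n.
set E := 1 / q%:R + _ + _ + _.
pose G m : R := lin_bound y%:R (m%:R * alpha).
have G0 m : 0 <= G m by rewrite lin_bound_ge0 // ltW.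
have QG : \sum_(1 <= j < K) weyl_sum y s (j%:R * alpha) <=
    \sum_(1 <= m < X.+1) (tau s m)%:R * G (c * m)%N.
  apply: le_trans (sum_weyl_sum_le _ _ _ _).
  by apply: ler_sum_index_iota => // j; exact: weyl_sum_ge0.
(* Since K <= y < x, X is at most x^(s+1); the additive 1 of the harmonic bound is absorbed by ln x
   >= 1. *)
have H_le : \sum_(1 <= m < X.+1) m%:R^-1 <= s.+2%:R * L :> R.
  apply: le_trans (harmonic_sum_le _ X0) _.
  have -> : s.+2%:R * L = L + L *+ s.+1 by rewrite -natr1 mulrDl mul1r mulr_natl addrC.
  have x0 : (0 < x)%N by lia.
  rewrite lerD // /L -lnXn ?ltr0n // ler_ln ?posrE ?exprn_gt0 ?ltr0n //.
  rewrite -natrX ler_nat expnS leq_mul //; first by lia.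
  by case: (s) => // s'; rewrite leq_exp2r // ltnW.
have H0 : 0 <= \sum_(1 <= m < X.+1) m%:R^-1 :> R.
  by apply: sumr_ge0 => m _; rewrite invr_ge0.
have tau_le : \sum_(1 <= m < X.+1) (tau s m)%:R ^+ 2 <=
    X%:R * (s.+2%:R ^+ (s.+1 ^ 2) * L ^+ (s.+1 ^ 2)) :> R.
  apply: le_trans (sum_tau_sqr_le _ _ _) _.
  rewrite ler_wpM2l // -exprMn lerXn2r ?nnegrE //.
  by rewrite mulr_ge0 //; lra.
have G_le : \sum_(1 <= m < X.+1) G (c * m)%N ^+ 2 <=
    24 * ((c * X)%:R / q%:R + 1) * (y%:R ^+ 2 + y%:R * q%:R).
  apply: le_trans (sum_multiples_le (fun m => G m ^+ 2) c X c0 _) _.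
    by move=> m; exact: sqr_ge0.
  rewrite (eq_bigr (fun m => lin_bound y%:R (alpha * m%:R) ^+ 2)).
    exact: sum_lin_bound_sqr_le alphaE.
  by move=> m _; rewrite /G mulrC.
apply: (@le_trans _ _ ((\sum_(1 <= m < X.+1) (tau s m)%:R * G (c * m)%N) ^+ 2)).
  apply: lerXn2r; rewrite ?nnegrE ?sumr_ge0 // => m _; first exact: weyl_sum_ge0.
  by rewrite mulr_ge0.
apply: le_trans (sum_CauchySchwarz _ _ _ _) _.
have sum0 (F : nat -> R) : 0 <= \sum_(1 <= m < X.+1) F m ^+ 2.
  by apply: sumr_ge0 => m _; exact: sqr_ge0.
apply: le_trans (ler_pM (sum0 _) (sum0 _) tau_le G_le) _.
set D := s.+2%:R ^+ _; set Lam := L ^+ _.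
have D0 : 0 <= D by rewrite exprn_ge0.
have Lam0 : 0 <= Lam by rewrite exprn_ge0 //; lra.
have E_le := error_terms_le K%:R y%:R q%:R s kR1 yR1 qR0; rewrite -/E in E_le.
have XE : X%:R = K%:R * y%:R ^+ s :> R by rewrite natrM natrX.
rewrite -XE in E_le.
have -> : K%:R * y%:R ^+ s.+1 = X%:R * y%:R :> R by rewrite XE exprSr mulrA.
have h1 : (c * X)%:R / q%:R + 1 <= c%:R * X%:R * (q%:R^-1 + X%:R^-1) :> R.
  rewrite natrM mulrDr lerD2l // mulfK ?gt_eqF //.
have h2 : y%:R ^+ 2 + y%:R * q%:R = y%:R ^+ 2 * (1 + q%:R / y%:R) :> R.
  by field; rewrite gt_eqF.
rewrite h2.
apply: (@le_trans _ _ (X%:R * (D * Lam) * (24 * (c%:R * X%:R * (q%:R^-1 + X%:R^-1)) *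
    (y%:R ^+ 2 * (1 + q%:R / y%:R))))).
  apply: ler_wpM2l; first by rewrite ?mulr_ge0.
  apply: ler_wpM2r; last exact: ler_wpM2l.
  by rewrite mulr_ge0 ?sqr_ge0 // addr_ge0 // divr_ge0.
have -> : X%:R * (D * Lam) * (24 * (c%:R * X%:R * (q%:R^-1 + X%:R^-1)) *
    (y%:R ^+ 2 * (1 + q%:R / y%:R))) =
   24 * c%:R * D * Lam * (X%:R * y%:R) ^+ 2 *
     ((q%:R^-1 + X%:R^-1) * (1 + q%:R / y%:R)) by ring.
have -> : 48 * c%:R * D * (Lam * E) * (X%:R * y%:R) ^+ 2 =
  24 * c%:R * D * Lam * (X%:R * y%:R) ^+ 2 * (2 * E) by ring.
by rewrite ler_wpM2l // ?mulr_ge0 ?sqr_ge0.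
Qed.

End MeanValue.

(** * Assembly of the estimates and extraction of the root *)

Section Conclusion.
Context {R : realType}.

(** Hölder over j brings in the power 2^s required by Weyl's inequality for j f; the further
    squaring matches the mean square bound for the sums [weyl_sum]. *)
Lemma sum_complete_sums_le (s : nat) : exists2 C : R, 1 <= C &
  forall (K x y q A : nat) (f : {poly R}) (theta : R) (a : int),
  (0 < K)%N -> (0 < y)%N -> (0 < q)%N -> (K <= y)%N -> (y < x)%N ->
  1 <= ln x%:R :> R -> (size f <= s.+2)%N ->
  f`_s.+1 = a%:~R / q%:R + theta / q%:R ^+ 2 ->
  coprimez a q%:Z -> `|theta| <= 1 ->
  (\sum_(1 <= j < K) normc (\sum_(A <= u < A + y) e (j%:R * f.[u%:R])))
    ^+ (2 ^ s * 2) <=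
  C * ((K%:R * y%:R) ^+ (2 ^ s * 2) * (ln x%:R ^+ (s.+1 ^ 2) *
    (1 / q%:R + 1 / y%:R + q%:R / (K%:R * y%:R ^+ s.+1) + 1 / K%:R ^+ (2 ^ s)))).
Proof.
have [C1 C11 weyl] := @weyl_inequality R s.
pose C2 : R := 48 * s.+1`!%:R * s.+2%:R ^+ (s.+1 ^ 2).
have C20 : 0 <= C2 by rewrite ?mulr_ge0 ?exprn_ge0.
(* The 2 is that of (a + b)^2 <= 2 (a^2 + b^2); 1 and [C2] pay for the diagonal term and for [Q]. *)
exists (2 * C1 ^+ 2 * (1 + C2)); first by nra.
move=> K x y q A f theta a K0 y0 q0 Ky yx L1 sf alphaE aq theta1.
have := sqr_sum_weyl_sum_le s K x y q f`_s.+1 theta a K0 y0 q0 Ky yx L1 alphaE aq theta1.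
rewrite -/C2.
set Lam := ln x%:R ^+ _.
set E := 1 / q%:R + _ + _ + _.
set Q := \sum_(1 <= j < K) weyl_sum _ _ _ => Q2.
pose T j := normc (\sum_(A <= u < A + y) e (j%:R * f.[u%:R])).
pose S := \sum_(1 <= j < K) T j; rewrite -/S.
have T0 j : 0 <= T j by exact: normc_ge0.
have Q0 : 0 <= Q by apply: sumr_ge0 => j _; exact: weyl_sum_ge0.
have k0 : 0 < K%:R :> R by rewrite ltr0n.
have yR0 : 0 < y%:R :> R by rewrite ltr0n.
have yR1 : 1 <= y%:R :> R by rewrite ler1n.
have S0 : 0 <= S by apply: sumr_ge0.
have Lam1 : 1 <= Lam by rewrite exprn_ege1.
(* Once squared, the diagonal term of Weyl's inequality is y^(-2) relative to the normalisation (K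
   y^(s+1))^2. *)
have yE : (y%:R ^+ 2)^-1 <= E.
  have -> : E = y%:R^-1 + (q%:R^-1 + q%:R / (K%:R * y%:R ^+ s.+1) + (K%:R ^+ (2 ^ s))^-1).
    by rewrite /E !div1r; ring.
  apply: ler_wpDr.
    by rewrite !addr_ge0 ?invr_ge0 ?divr_ge0 ?mulr_ge0 ?exprn_ge0 ?(ltW yR0) ?(ltW k0).
  by rewrite lef_pV2 ?posrE ?exprn_gt0 // expr2 ler_peMr // ltW.
have E0 : 0 <= E by apply: le_trans yE; rewrite invr_ge0 exprn_ge0 ?(ltW yR0).
set N := (2 ^ s)%N in weyl *.
set k := K%:R in k0 *; set Y := y%:R in yR0 yR1 yE Q2 weyl *.
have TN j : Y ^+ s.+1 * T j ^+ N <=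
    C1 * (Y ^+ (N + s) + Y ^+ N * weyl_sum y s (j%:R * f`_s.+1)).
  have := weyl (j%:R *: f) A%:R y y (leq_trans (size_scale_leq _ _) sf) (leqnn _) y0.
  rewrite coefZ; apply: le_trans; rewrite ler_wpM2l ?exprn_ge0 ?(ltW yR0) //.
  rewrite /T [(A + y)%N]addnC -{1}[A]add0n big_addn addnK.
  by under eq_bigr do rewrite natrD addrC -hornerZ.
have SN : k * S ^+ N <= k ^+ N * \sum_(1 <= j < K) T j ^+ N.
  by apply: sum_pow2_le => //; rewrite size_iota ler_nat leq_subr.
have sumTN : Y ^+ s.+1 * \sum_(1 <= j < K) T j ^+ N <=
    C1 * (k * Y ^+ (N + s) + Y ^+ N * Q).
  rewrite mulr_sumr; apply: le_trans (ler_sum _ (fun j _ => TN j)) _.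
  rewrite -mulr_sumr big_split /= -mulr_sumr big_const_nat iter_addr_0.
  rewrite ler_wpM2l ?lerD2r //; first by lra.
  by rewrite mulr_natl ler_wpMn2l ?exprn_ge0 ?(ltW yR0) // leq_subr.
have main : Y ^+ s.+1 * (k * S ^+ N) <= k ^+ N * (C1 * (k * Y ^+ (N + s) + Y ^+ N * Q)).
  apply: le_trans (ler_wpM2l (exprn_ge0 _ (ltW yR0)) SN) _.
  by rewrite mulrCA ler_wpM2l ?exprn_ge0 ?(ltW k0).
have kY0 : 0 < (Y ^+ s.+1 * k) ^+ 2 by rewrite exprn_gt0 // mulr_gt0 ?exprn_gt0.
rewrite -(ler_pM2l kY0).
apply: (@le_trans _ _ ((k ^+ N * (C1 * (k * Y ^+ (N + s) + Y ^+ N * Q))) ^+ 2)).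
  rewrite exprM -exprMn -mulrA.
  have l0 : 0 <= Y ^+ s.+1 * (k * S ^+ N).
    by rewrite ?mulr_ge0 ?exprn_ge0 ?(ltW yR0) ?(ltW k0).
  by apply: lerXn2r; rewrite ?nnegrE // (le_trans l0).
have -> : (k ^+ N * (C1 * (k * Y ^+ (N + s) + Y ^+ N * Q))) ^+ 2 =
    (k * Y) ^+ (N * 2) * (C1 ^+ 2 * (k * Y ^+ s + Q) ^+ 2).
  have -> : (k * Y) ^+ (N * 2) = (k ^+ N * Y ^+ N) ^+ 2 by rewrite exprM exprMn.
  by rewrite exprD; ring.
have -> : (Y ^+ s.+1 * k) ^+ 2 * (2 * C1 ^+ 2 * (1 + C2) * ((k * Y) ^+ (N * 2) * (Lam * E))) =
    (k * Y) ^+ (N * 2) * (C1 ^+ 2 * (2 * ((1 + C2) * (Lam * E) * (k * Y ^+ s.+1) ^+ 2))).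
  by ring.
rewrite ler_wpM2l ?exprn_ge0 ?mulr_ge0 ?(ltW k0) ?(ltW yR0) //.
rewrite ler_wpM2l ?sqr_ge0 //.
apply: (@le_trans _ _ (2 * ((k * Y ^+ s) ^+ 2 + Q ^+ 2))).
  by have := sqr_ge0 (k * Y ^+ s - Q); lra.
rewrite ler_wpM2l // [(1 + C2) * _]mulrDl mul1r mulrDl lerD //.
have -> : (k * Y ^+ s) ^+ 2 = (Y ^+ 2)^-1 * (k * Y ^+ s.+1) ^+ 2.
  by rewrite [Y ^+ s.+1]exprS; field; rewrite gt_eqF.
rewrite ler_wpM2r ?sqr_ge0 //; apply: le_trans yE _.
by rewrite ler_peMl.
Qed.

Lemma powR_invn_exp (a b : R) (m : nat) : (0 < m)%N ->
  (a `^ (b / m%:R)) ^+ m = a `^ b.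
Proof.
move=> m0; rewrite -powR_mulrn ?powR_ge0 // -powRrM divfK //.
by rewrite pnatr_eq0 -lt0n.
Qed.

(** The constant survives the m-th root unchanged because c <= c^m for c >= 1. *)
Lemma root_le (v c b E L : R) (m d : nat) : (0 < m)%N ->
  0 <= v -> 1 <= c -> 0 <= b -> 0 <= E -> 0 <= L ->
  v ^+ m <= c * (b ^+ m * (E * L ^+ d)) ->
  v <= c * (b * E `^ m%:R^-1 * L `^ (d%:R / m%:R)).
Proof.
move=> m0 v0 c1 b0 E0 L0 vm.
have c0 : 0 <= c by exact: le_trans c1.
have r0 : 0 <= c * (b * E `^ m%:R^-1 * L `^ (d%:R / m%:R)).
  by rewrite !mulr_ge0 ?powR_ge0.
rewrite -(ler_pXn2r m0) ?nnegrE //; apply: le_trans vm _.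
have Em : (E `^ m%:R^-1) ^+ m = E.
  by rewrite -[m%:R^-1]mul1r powR_invn_exp // powRr1.
have Lm : (L `^ (d%:R / m%:R)) ^+ m = L ^+ d.
  by rewrite powR_invn_exp // powR_mulrn.
have -> : (c * (b * E `^ m%:R^-1 * L `^ (d%:R / m%:R))) ^+ m =
    c ^+ m * (b ^+ m * (E * L ^+ d)).
  by rewrite exprMn exprMn exprMn Em Lm -mulrA.
apply: ler_wpM2r; first by rewrite !mulr_ge0 ?exprn_ge0.
by rewrite ler_eXnr.
Qed.

End Conclusion.

Theorem theorem1 (R : realType) (n : nat) (hn : (0 < n)%N) :
  exists (C : R) (N0 : nat), 0 < C /\
  forall (K x y q : nat) (f : {poly R}) (alpha theta : R) (a : int),
    (N0 <= K)%N -> (N0 <= x)%N -> (N0 <= y)%N -> (N0 <= q)%N ->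
    (K <= y)%N -> (y < x)%N ->
    size f = n.+1 -> f`_n = alpha -> f`_0 = 0 ->
    alpha = a%:~R / q%:R + theta / q%:R ^+ 2 ->
    coprimez a q%:Z -> (1 <= q)%N -> `|theta| <= 1 ->
    V f K x y <=
      C * (K%:R * y%:R *
        (1 / q%:R + 1 / y%:R + q%:R / (K%:R * y%:R ^+ n)
           + 1 / K%:R ^+ (2 ^ n.-1)%N) `^ (2 ^- n.+1)
        * (ln x%:R) `^ ((n ^ 2)%N%:R / 2 ^+ n.+1)).
Proof.
case: n hn => // s _; rewrite [s.+1.-1]/=.
have [C1 C11 sumT] := @sum_complete_sums_le R s.
pose C3 : R := 4 ^+ (2 ^ s * 2) * (1 + C1).
have C31 : 1 <= C3 by rewrite mulr_ege1 ?exprn_ege1 //; lra.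
(* The threshold exceeds e, which guarantees ln x >= 1. *)
exists C3, (Num.trunc (expR 1 : R)).+1; split; first by lra.
move=> K x y q f alpha theta a hK hx hy hq Ky yx sf <- _ alphaE aq q0 theta1.
have K0 : (0 < K)%N by apply: leq_trans hK.
have y0 : (0 < y)%N by apply: leq_trans hy.
have x0 : (0 < x)%N by apply: leq_trans hx.
have L1 : 1 <= ln x%:R :> R.
  rewrite -[leLHS](expRK 1) ler_ln ?posrE ?expR_gt0 ?ltr0n //.
  apply/ltW/(lt_le_trans (truncnS_gt _)); by rewrite ler_nat.
have k0 : 0 < K%:R :> R by rewrite ltr0n.
have k1 : 1 <= K%:R :> R by rewrite ler1n.
have Y0 : 0 < y%:R :> R by rewrite ltr0n.
have := sumT K x y q (x - y).+1 f theta a K0 y0 q0 Ky yx L1 _ alphaE aq theta1.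
rewrite sf => /(_ (leqnn _)).
set Lam := ln x%:R ^+ _.
set E := 1 / q%:R + _ + _ + _.
set S := \sum_(1 <= j < K) _ => SN.
have S0 : 0 <= S by apply: sumr_ge0 => j _; exact: normc_ge0.
(* The diagonal y of the first Cauchy inequality, raised to the power 2^(s+1), is (K y)^(2^(s+1))
   times this quantity. *)
have kE : (K%:R ^+ (2 ^ s * 2))^-1 <= E.
  have -> : E = (K%:R ^+ (2 ^ s))^-1 + (q%:R^-1 + y%:R^-1 + q%:R / (K%:R * y%:R ^+ s.+1)).
    by rewrite /E !div1r; ring.
  apply: ler_wpDr.
    by rewrite !addr_ge0 ?invr_ge0 ?divr_ge0 ?mulr_ge0 ?exprn_ge0 ?(ltW Y0) ?(ltW k0).
  by rewrite lef_pV2 ?posrE ?exprn_gt0 // ler_weXn2l // leq_pmulr.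
have E0 : 0 <= E by apply: le_trans kE; rewrite invr_ge0 exprn_ge0 ?(ltW k0).
have Lam1 : 1 <= Lam by rewrite exprn_ege1.
have V0 : 0 <= V f K x y by apply: sumr_ge0 => k _; exact: normc_ge0.
have V2 : V f K x y ^+ 2 <= y%:R * K%:R * (y%:R + 2 * S).
  (* The interval (x - y, x] becomes [A, A + y) with A = x - y + 1. *)
  have xE : x.+1 = ((x - y).+1 + y)%N by rewrite addSn subnK // ltnW.
  rewrite /V xE; exact: sqr_sum_normc_le (fun u => f.[u%:R]) prime K y (x - y).+1.
set M := (2 ^ s * 2)%N in C3 C31 SN kE *.
have M2 : (2 ^ s.+2 = 2 * M)%N by rewrite /M 2!expnS [(2 ^ s * 2)%N]mulnC.
have V4 : V f K x y ^+ (2 * M) <= C3 * ((K%:R * y%:R) ^+ (2 * M) * (E * Lam)).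
  rewrite exprM.
  apply: le_trans (lerXn2r _ _ _ V2) _.
  all: rewrite ?nnegrE ?sqr_ge0 ?mulr_ge0 ?addr_ge0 ?mulr_ge0 //.
  rewrite exprMn [y%:R * K%:R]mulrC.
  have h : (y%:R + 2 * S) ^+ M <= C3 * ((K%:R * y%:R) ^+ M * (E * Lam)).
    apply: le_trans (exprD_le _ _ _ _ _) _; rewrite ?mulr_ge0 // exprMn.
    rewrite /C3 (_ : 4 = 2 * 2 :> R); last by ring.
    rewrite exprMn -!mulrA ler_wpM2l ?exprn_ge0 //.
    have yM : y%:R ^+ M <= (K%:R * y%:R) ^+ M * (E * Lam).
      have -> : y%:R ^+ M = (K%:R * y%:R) ^+ M * (K%:R ^+ M)^-1 :> R.
        by rewrite exprMn mulrAC divff ?mul1r // gt_eqF ?exprn_gt0.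
      rewrite ler_wpM2l ?exprn_ge0 ?mulr_ge0 //.
      by apply: le_trans kE _; rewrite ler_peMr.
    have yM' : y%:R ^+ M <= 2 ^+ M * ((K%:R * y%:R) ^+ M * (E * Lam)).
      apply: le_trans yM _; rewrite ler_peMl ?mulr_ge0 ?exprn_ge0 ?mulr_ge0 //; first by lra.
      by rewrite exprn_ege1 //; lra.
    rewrite mulrDl mul1r mulrDr lerD // ler_wpM2l ?exprn_ge0 //.
    by apply: le_trans SN _; rewrite [Lam * E]mulrC.
  have := ler_wpM2l (exprn_ge0 M (mulr_ge0 (ltW k0) (ltW Y0))) h.
  by move=> /le_trans; apply; rewrite mul2n -addnn exprD mulrCA -mulrA.
have b0 : 0 <= K%:R * y%:R :> R by rewrite mulr_ge0 ?ltW.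
have M0 : (0 < 2 * M)%N by rewrite -M2 expn_gt0.
rewrite -!natrX M2; exact: root_le (le_trans ler01 L1) V4.
Qed.
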